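(* For every $X\in ES$, the class of clear grand-coalition-first action $X$-models is $z$-representable by the class of clear single-coalition-first neighborhood $X$-models; that is, every clear grand-coalition-first action $X$-model is $z$-representable by some clear single-coalition-first neighborhood $X$-model, and every clear single-coalition-first neighborhood $X$-model $z$-represents some clear grand-coalition-first action $X$-model.
   Context: $AG$ is a finite nonempty set of agents, $AP$ a countable set of atomic propositions. For a nonempty set $AC$ and $C\subseteq AG$, $JA_C$ is the set of functions $\sigma_C:C\to AC$ ($JA_\emptyset=\{\emptyset\}$); $\sigma_C\subseteq\sigma_{AG}$ means $\sigma_C$ is the restriction of $\sigma_{AG}$ to $C$; for disjoint $C,D$, $\sigma_C\cup\sigma_D\in JA_{C\cup D}$. A grand-coalition-first action model is $M=(ST,AC,out_{AG},L)$ with $ST,AC$ nonempty, $out_{AG}:ST\times JA_{AG}\to\mathcal P(ST)$, $L:ST\to\mathcal P(AP)$. It determines $out_C(s,\sigma_C)=\bigcup\{out_{AG}(s,\sigma_{AG})\mid\sigma_C\subseteq\sigma_{AG}\}$, $av_C(s)=\{\sigma_C\mid out_C(s,\sigma_C)\neq\emptyset\}$, $AE_C(s)=\{out_C(s,\sigma_C)\mid\sigma_C\in av_C(s)\}$. $M$ is clear if for all $s$ and $\sigma_{AG}\neq\sigma'_{AG}$, $out_{AG}(s,\sigma_{AG})\cap out_{AG}(s,\sigma'_{AG})=\emptyset$; serial if $av_C(s)\neq\emptyset$ for all $C,s$; independent if for all $s$, disjoint $C,D$, $\sigma_C\in av_C(s)$, $\sigma_D\in av_D(s)$: $\sigma_C\cup\sigma_D\in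 av_{C\cup D}(s)$; deterministic if $out_{AG}(s,\sigma_{AG})$ is a singleton for all $s$ and $\sigma_{AG}\in av_{AG}(s)$. A single-coalition-first neighborhood model is $N=(ST,suc,\{nei_a\}_{a\in AG},L)$ with $ST$ nonempty, $suc:ST\to\mathcal P(ST)$, $L:ST\to\mathcal P(AP)$, each $nei_a(s)\subseteq\mathcal P(ST)$ a cover of $suc(s)$ (union $suc(s)$, $\emptyset\notin nei_a(s)$). With $\Delta_1\odot\Delta_2=\{Y_1\cap Y_2\mid Y_i\in\Delta_i,Y_1\cap Y_2\neq\emptyset\}$ (extended to finitely many families, $\bigodot\{\Delta\}=\Delta$): $nei_C(s)=\emptyset$ if $suc(s)=\emptyset$; $\{suc(s)\}$ if $suc(s)\neq\emptyset$, $C=\emptyset$; $\bigodot\{nei_a(s)\mid a\in C\}$ otherwise. $N$ is clear if each $nei_a(s)$ is a partition of $suc(s)$; serial if $nei_C(s)\neq\emptyset$ for all $C,s$; independent if for all $s$, disjoint $C,D$, $Y_1\in nei_C(s)$, $Y_2\in nei_D(s)$: $Y_1\cap Y_2\neq\emptyset$; deterministic if every $Y\in nei_{AG}(s)$ is a singleton. $ES=\{\epsilon,\mathtt S,\mathtt I,\mathtt D,\mathtt{SI},\mathtt{SD},\mathtt{ID},\mathtt{SID}\}$; an $X$-model has the properties whose letters ($\mathtt S$ serial, $\mathtt I$ independent, $\mathtt D$ deterministic) occur in $X$. $M$ is $z$-representable by $N$ ($N$ $z$-represents $M$) if they share $ST$ and $L$ and $AE_C=nei_C$ for all $C\subseteq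 AG$. *)

(* Defs.v *)
From mathcomp Require Import all_boot.
From mathcomp Require Import boolp classical_sets.

Set Implicit Arguments.
Unset Strict Implicit.
Unset Printing Implicit Defensive.

Local Open Scope classical_set_scope.

(* [AG] is the set of agents and [AP] the set of atomic propositions. Both
   kinds of models are parameterized by their type of states [ST], so that two
   models sharing their states are just two models over the same [ST]. *)

Section JointActions.
Variables (AG : finType) (AC : Type).

Definition JA (C : {set AG}) : Type := {a : AG | a \in C} -> AC.

Definition ja_restr (C : {set AG}) (f : JA (finset.setT : {set AG})) : JA C :=
  fun x => f (exist _ (sval x) (finset.in_setT (sval x))).

Definition ja_sub (C : {set AG}) (g : JA C) (f : JA finset.setT) : Prop :=
  g = ja_restr f.

Lemma in_setU_right (C D : {set AG}) (a : AG) :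
  a \in C :|: D -> a \notin C -> a \in D.
Proof. by rewrite finset.in_setU => /orP[->|]. Qed.

(* Only meaningful for disjoint [C] and [D]; [f] takes precedence on [C]. *)
Definition ja_union (C D : {set AG}) (f : JA C) (g : JA D) : JA (C :|: D) :=
  fun x =>
    match boolP (sval x \in C) with
    | AltTrue h => f (exist _ (sval x) h)
    | AltFalse h => g (exist _ (sval x) (in_setU_right (svalP x) h))
    end.

End JointActions.

Record action_model (AG : finType) (AP : countType) (ST : Type) := ActionModel {
  am_AC : Type ;
  am_out : ST -> JA am_AC (finset.setT : {set AG}) -> set ST ;
  am_L : ST -> set AP ;
  am_ST_inhabited : inhabited ST ;
  am_AC_inhabited : inhabited am_AC }.

Section ActionModels.
Variables (AG : finType) (AP : countType) (ST : Type).
Variable M : action_model AG AP ST.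

Definition outC (C : {set AG}) (s : ST) (f : JA (am_AC M) C) : set ST :=
  \bigcup_(g in [set g | ja_sub f g]) am_out s g.

Definition av (C : {set AG}) (s : ST) : set (JA (am_AC M) C) :=
  [set f | outC s f !=set0].
Arguments av : clear implicits.

Definition AE (C : {set AG}) (s : ST) : set (set ST) :=
  [set outC s f | f in av C s].

Definition am_clear : Prop :=
  forall s (f g : JA (am_AC M) finset.setT),
    f <> g -> am_out s f `&` am_out s g = set0.

Definition am_serial : Prop := forall (C : {set AG}) s, av C s !=set0.

Definition am_independent : Prop :=
  forall s (C D : {set AG}), C :&: D = finset.set0 ->
  forall (f : JA (am_AC M) C) (g : JA (am_AC M) D),
    av C s f -> av D s g -> av (C :|: D) s (ja_union f g).

Definition am_deterministic : Prop :=
  forall s (f : JA (am_AC M) finset.setT),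
    av finset.setT s f -> exists t, am_out s f = [set t].

End ActionModels.

Record nbhd_model (AG : finType) (AP : countType) (ST : Type) := NbhdModel {
  nm_suc : ST -> set ST ;
  nm_nei : AG -> ST -> set (set ST) ;
  nm_L : ST -> set AP ;
  nm_ST_inhabited : inhabited ST ;
  nm_cover : forall a s, cover (nm_nei a s) id = nm_suc s ;
  nm_nei_neq0 : forall a s, ~ nm_nei a s set0 }.

Section Odot.
Variable T : Type.

Definition odot (D1 D2 : set (set T)) : set (set T) :=
  [set Y | exists Y1 Y2,
    [/\ D1 Y1, D2 Y2, Y1 `&` Y2 <> set0 & Y = Y1 `&` Y2]].

(* [odot] is associative and commutative, so the order of the list does not
   matter. The value on the empty list is a dummy one. *)
Fixpoint bigodot (Ds : seq (set (set T))) : set (set T) :=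
  match Ds with
  | [::] => set0
  | [:: D] => D
  | D :: Ds' => odot D (bigodot Ds')
  end.

End Odot.

Section NbhdModels.
Variables (AG : finType) (AP : countType) (ST : Type).
Variable N : nbhd_model AG AP ST.

Definition neiC (C : {set AG}) (s : ST) : set (set ST) :=
  if `[< nm_suc N s = set0 >] then set0
  else if C == finset.set0 then [set nm_suc N s]
  else bigodot [seq nm_nei N a s | a <- enum C].

Definition nm_clear : Prop :=
  forall a s, partition (nm_nei N a s) id (nm_suc N s).

Definition nm_serial : Prop := forall (C : {set AG}) s, neiC C s !=set0.

Definition nm_independent : Prop :=
  forall s (C D : {set AG}), C :&: D = finset.set0 ->
  forall Y1 Y2, neiC C s Y1 -> neiC D s Y2 -> Y1 `&` Y2 !=set0.

Definition nm_deterministic : Prop :=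
  forall s Y, neiC finset.setT s Y -> exists t, Y = [set t].

End NbhdModels.

Inductive ES := ES_eps | ES_S | ES_I | ES_D | ES_SI | ES_SD | ES_ID | ES_SID.

Definition has_S (X : ES) : bool :=
  match X with ES_S | ES_SI | ES_SD | ES_SID => true | _ => false end.
Definition has_I (X : ES) : bool :=
  match X with ES_I | ES_SI | ES_ID | ES_SID => true | _ => false end.
Definition has_D (X : ES) : bool :=
  match X with ES_D | ES_SD | ES_ID | ES_SID => true | _ => false end.

Section Representation.
Variables (AG : finType) (AP : countType).

Definition action_X_model (X : ES) (ST : Type) (M : action_model AG AP ST) :=
  [/\ has_S X -> am_serial M,
      has_I X -> am_independent M &
      has_D X -> am_deterministic M].

Definition nbhd_X_model (X : ES) (ST : Type) (N : nbhd_model AG AP ST) :=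
  [/\ has_S X -> nm_serial N,
      has_I X -> nm_independent N &
      has_D X -> nm_deterministic N].

Definition z_representable (ST : Type)
    (M : action_model AG AP ST) (N : nbhd_model AG AP ST) : Prop :=
  am_L M = nm_L N /\ forall C : {set AG}, AE M C = neiC N C.

Definition class_z_representable
    (K : forall ST : Type, action_model AG AP ST -> Prop)
    (K' : forall ST : Type, nbhd_model AG AP ST -> Prop) : Prop :=
  (forall (ST : Type) (M : action_model AG AP ST), K ST M ->
     exists N : nbhd_model AG AP ST, K' ST N /\ z_representable M N) /\
  (forall (ST : Type) (N : nbhd_model AG AP ST), K' ST N ->
     exists M : action_model AG AP ST, K ST M /\ z_representable M N).

End Representation.

(* Main.v *)
Require Import Defs.
From mathcomp Require Import all_boot.
From mathcomp Require Import boolp classical_sets.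

(** Both a clear action model and a clear neighborhood model are determined, at
    a state [s], by the successor set and by one partition of it per agent: a
    set is a result of the coalition [C] iff it is the set of successors lying
    in the same block as some fixed successor [t] for every agent of [C].
    Hence representability only has to be checked for the successor set and
    for single agents. From an action model take [AE M [set a]] as the
    neighborhoods of [a]; from a neighborhood model let the actions be sets of
    states, [a] choosing the block [f a]. The three optional properties
    transfer because in a clear model they only depend on the sets [AE M C];
    for independence, this is since
    [outC s (ja_union f g) = outC s f `&` outC s g]. *)

Set Implicit Arguments.
Unset Strict Implicit.
Unset Printing Implicit Defensive.

Local Open Scope classical_set_scope.

(** * Common refinements of partitions *)

Section JointBlocks.
Variables (T I : Type).
Implicit Types (S Z : set T) (D : I -> set (set T)) (P : set I).

(** When every [D i] partitions [S], this is the class of [t] in the common refinement of the [D i]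
    with [i] in [P]. For empty [P] it is all of [S], as the convention for the empty coalition
    demands. *)
Definition joint_block S D P (t : T) : set T :=
  [set u | S u /\ forall i, P i -> exists2 Z, D i Z & Z u /\ Z t].

Lemma partition_blockE (E : set (set T)) S Z (t u : T) :
  partition E id S -> E Z -> Z t ->
  (exists2 Z', E Z' & Z' u /\ Z' t) <-> Z u.
Proof.
move=> [_ tE _] EZ Zt; split=> [[Z' EZ' [Z'u Z't]]|Zu]; last by exists Z.
by rewrite (tE Z Z' EZ EZ') //; exists t.
Qed.

Lemma partition_block (E : set (set T)) S (t : T) :
  partition E id S -> S t -> exists2 Z, E Z & Z t.
Proof. by move=> [<- _ _] [Z EZ Zt]; exists Z. Qed.

Lemma partition_subset (E : set (set T)) S Z :
  partition E id S -> E Z -> Z `<=` S.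
Proof. by move=> [<- _ _] EZ t Zt; exists Z. Qed.

Lemma joint_block_refl S D P t :
  (forall i, partition (D i) id S) -> S t -> joint_block S D P t t.
Proof.
move=> pD St; split=> // i _.
by have [Z DZ Zt] := partition_block (pD i) St; exists Z.
Qed.

Lemma joint_block_eq S D P t u :
  (forall i, partition (D i) id S) ->
  joint_block S D P t u -> joint_block S D P t = joint_block S D P u.
Proof.
move=> pD [Su tu]; apply/seteqP; split=> v [Sv vP]; split=> // i Pi.
- have [Z DZ [Zu Zt]] := tu i Pi.
  exists Z => //; split=> //.
  exact/(partition_blockE _ (pD i) DZ Zt)/vP.
- have [Z DZ [Zu Zt]] := tu i Pi.
  exists Z => //; split=> //.
  exact/(partition_blockE _ (pD i) DZ Zu)/vP.
Qed.

Lemma joint_blockU S D P Q t :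
  joint_block S D (P `|` Q) t = joint_block S D P t `&` joint_block S D Q t.
Proof.
apply/seteqP; split=> [u [Su uPQ]|u [[Su uP] [_ uQ]]].
  by split; split=> // i Hi; apply: uPQ; [left|right].
by split=> // i [/uP|/uQ].
Qed.

Lemma joint_block1 S D i :
  (forall j, partition (D j) id S) ->
  D i = [set joint_block S D [set i] t | t in S].
Proof.
move=> pD.
have key Z t : D i Z -> Z t -> joint_block S D [set i] t = Z.
  move=> DZ Zt; apply/seteqP; split=> u.
    by move=> [_ /(_ i erefl)]; apply: (partition_blockE u (pD i) DZ Zt).1.
  move=> Zu; split; first exact: (partition_subset (pD i) DZ Zu).
  by move=> _ ->; exists Z.
apply/seteqP; split=> [Z DZ|_ [t St <-]].
  have [_ _ /(_ Z DZ) [t Zt]] := pD i.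
  by exists t; [exact: (partition_subset (pD i) DZ)|exact: key].
by have [Z DZ Zt] := partition_block (pD i) St; rewrite (key Z).
Qed.

(** If a block for [P] and a block for [Q] meet in [u], both are the blocks of [u], so they
    intersect in the block of [u] for the union. Conversely, the two blocks of any [t] in [S] meet,
    in [t] itself. *)
Lemma odot_joint_block S D P Q :
  (forall i, partition (D i) id S) ->
  odot [set joint_block S D P t | t in S] [set joint_block S D Q t | t in S] =
  [set joint_block S D (P `|` Q) t | t in S].
Proof.
move=> pD; apply/seteqP; split.
  move=> _ [_ [_ [[t St <-] [t' St' <-] /eqP/set0P[u [tu t'u]] ->]]].
  exists u; first by case: tu.
  by rewrite joint_blockU (joint_block_eq pD tu) (joint_block_eq pD t'u).
move=> _ [t St <-]; exists (joint_block S D P t), (joint_block S D Q t).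
split; [by exists t|by exists t| |exact: joint_blockU].
by apply/eqP/set0P; exists t; split; exact: joint_block_refl.
Qed.

End JointBlocks.

(** The induction starts at one-element lists, since [bigodot] takes a dummy value on the empty
    list. *)
Lemma bigodot_joint_block (T : Type) (I : eqType) (S : set T)
    (D : I -> set (set T)) (l : seq I) :
  (forall i, partition (D i) id S) -> l != [::] ->
  bigodot [seq D i | i <- l] =
  [set joint_block S D [set i | i \in l] t | t in S].
Proof.
move=> pD; elim: l => // i [_ _|j l IH _].
  rewrite /= (joint_block1 i pD).
  suff -> : [set i0 | i0 \in [:: i]] = [set i] by [].
  by apply/seteqP; split=> k /=; rewrite inE => /eqP.
change (odot (D i) (bigodot [seq D i | i <- j :: l]) =
  [set joint_block S D [set i0 | i0 \in [:: i, j & l]] t | t in S]).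
rewrite IH // (joint_block1 i pD) odot_joint_block //.
suff -> : [set i0 | i0 \in [:: i, j & l]] = [set i] `|` [set i0 | i0 \in j :: l].
  by [].
apply/seteqP; split=> k /=; rewrite in_cons => /predU1P; exact.
Qed.

(** One formula covers the three cases of [neiC]: without successors no [t] is left to range over,
    and without agents the joint block is unconstrained. *)
Lemma neiC_joint_block (AG : finType) (AP : countType) (ST : Type)
    (N : nbhd_model AG AP ST) (C : {set AG}) (s : ST) :
  nm_clear N ->
  neiC N C s =
  [set joint_block (nm_suc N s) (fun a => nm_nei N a s) [set a | a \in C] t
    | t in nm_suc N s].
Proof.
move=> cN; rewrite /neiC; case: asboolP => [->|/eqP/set0P[t0 St0]].
  by apply/seteqP; split=> // Y [].
case: eqP => [->|/eqP C0].
  have E t : joint_block (nm_suc N s) (fun a => nm_nei N a s)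
      [set a | a \in finset.set0] t = nm_suc N s.
    by apply/seteqP; split=> [u []|u Su] //; split=> // a /=; rewrite finset.in_set0.
  apply/seteqP; split=> [Y /= ->|Y [t St <-]]; last exact: E.
  by exists t0; rewrite ?E.
rewrite (bigodot_joint_block (cN^~ s)).
  suff -> : [set i | i \in enum C] = [set a | a \in C] by [].
  by apply/seteqP; split=> a /=; rewrite mem_enum.
apply: contra C0 => /eqP e; apply/eqP/setP => a.
by rewrite -mem_enum e finset.inE.
Qed.

(** * Restrictions and unions of joint actions *)

Section Actions.
Variables (AG : finType) (AC : Type).
Implicit Types C D : {set AG}.

Definition act (f : JA AC (finset.setT : {set AG})) (a : AG) : AC :=
  f (exist _ a (finset.in_setT a)).

Lemma ja_irr C (f : JA AC C) (a : AG) (h h' : a \in C) :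
  f (exist _ a h) = f (exist _ a h').
Proof. by rewrite (bool_irrelevance h h'). Qed.

Lemma ja_ext C (f g : JA AC C) :
  (forall a (h : a \in C), f (exist _ a h) = g (exist _ a h)) -> f = g.
Proof. by move=> fg; apply/funext => -[a h]; exact: fg. Qed.

Lemma act_inj (f g : JA AC (finset.setT : {set AG})) : act f =1 act g -> f = g.
Proof.
move=> fg; apply: ja_ext => a h.
by rewrite (ja_irr f h (finset.in_setT a)) (ja_irr g h (finset.in_setT a)); exact: fg.
Qed.

Lemma ja_restr_eq C (f g : JA AC (finset.setT : {set AG})) :
  ja_restr f = ja_restr g :> JA AC C <-> {in C, act f =1 act g}.
Proof.
split=> [e a h|e]; last by apply: ja_ext => a h; exact: e.
exact: (congr1 (fun k : JA AC C => k (exist _ a h)) e).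
Qed.

Lemma ja_restrT (f : JA AC (finset.setT : {set AG})) : ja_restr f = f.
Proof. by apply: ja_ext => a h; exact: (ja_irr f). Qed.

Lemma ja_unionl C D (f : JA AC C) (g : JA AC D) a (hU : a \in C :|: D)
    (h : a \in C) :
  ja_union f g (exist _ a hU) = f (exist _ a h).
Proof.
(* The branch of [boolP] brings its own proof of membership, which [ja_irr] exchanges for [h]. *)
rewrite /ja_union /=; case: {-}_ / (boolP (a \in C)) => [h'|]; first exact: ja_irr.
by move=> nC; exfalso; move: nC; rewrite h.
Qed.

Lemma ja_unionr C D (f : JA AC C) (g : JA AC D) a (hU : a \in C :|: D)
    (h : a \in D) :
  a \notin C -> ja_union f g (exist _ a hU) = g (exist _ a h).
Proof.
move=> nC; rewrite /ja_union /=.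
case: {-}_ / (boolP (a \in C)) => [h'|h']; last exact: ja_irr.
by exfalso; move: nC; rewrite h'.
Qed.

Lemma ja_sub_union C D (f : JA AC C) (g : JA AC D) h :
  C :&: D = finset.set0 ->
  ja_sub (ja_union f g) h <-> ja_sub f h /\ ja_sub g h.
Proof.
move=> CD0; split=> [e|[-> ->]]; last first.
  apply: ja_ext => a ha; have [aC|aC] := boolP (a \in C).
    exact: (ja_unionl _ _ ha aC).
  exact: (ja_unionr _ _ ha (in_setU_right ha aC)).
have eU a (ha : a \in C :|: D) : ja_union f g (exist _ a ha) = act h a.
  exact: (congr1 (fun k : JA AC (C :|: D) => k (exist _ a ha)) e).
split; apply: ja_ext => a ha.
  have haU : a \in C :|: D by rewrite finset.in_setU ha.
  by rewrite -(ja_unionl f g haU); exact: eU.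
have haU : a \in C :|: D by rewrite finset.in_setU ha orbT.
rewrite -(ja_unionr f g haU); first exact: eU.
apply/negP => aC; have : a \in C :&: D by rewrite finset.in_setI aC ha.
by rewrite CD0 finset.in_set0.
Qed.

End Actions.

(** * Results of coalitions in clear action models *)

Section ClearActionModels.
Variables (AG : finType) (AP : countType) (ST : Type).
Variable M : action_model AG AP ST.
Implicit Types (C D : {set AG}) (s t u : ST).

Definition am_suc s : set ST :=
  [set t | exists f : JA (am_AC M) finset.setT, am_out s f t].

Lemma outC_suc C s (f : JA (am_AC M) C) : outC s f `<=` am_suc s.
Proof. by move=> t [g _ gt]; exists g. Qed.

Lemma outC_T s (f : JA (am_AC M) finset.setT) : outC s f = am_out s f.
Proof.
apply/seteqP; split=> [t [g]|t ft]; first by rewrite /= /ja_sub ja_restrT => ->.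
by exists f => //=; rewrite /ja_sub ja_restrT.
Qed.

Lemma am_serialE : am_serial M <-> forall C s, AE M C s !=set0.
Proof.
split=> H C s; have [] := H C s; first by move=> f fP; exists (outC s f), f.
by move=> _ [f fP _]; exists f.
Qed.

Lemma am_deterministicE :
  am_deterministic M <->
  forall s Y, AE M finset.setT s Y -> exists t, Y = [set t].
Proof.
split=> H s.
  by move=> _ [f fP <-]; rewrite outC_T; exact: H.
by move=> f fP; rewrite -outC_T; apply: (H s); exists f.
Qed.

Hypothesis cM : am_clear M.

(** The form in which clearness is used: a successor determines the joint action of all agents that
    leads to it. *)
Lemma am_out_inj s (f g : JA (am_AC M) finset.setT) t :
  am_out s f t -> am_out s g t -> f = g.
Proof.
move=> ft gt; apply: contrapT => /(cM s) /seteqP[/(_ t) H _].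
exact: H.
Qed.

(** For the inclusion from right to left, a profile extending [f] and one extending [g] that lead to
    the same [t] are equal, so a single profile extends both. *)
Lemma outC_union C D s (f : JA (am_AC M) C) (g : JA (am_AC M) D) :
  C :&: D = finset.set0 ->
  outC s (ja_union f g) = outC s f `&` outC s g.
Proof.
move=> CD0; apply/seteqP; split=> [t [h /(ja_sub_union _ _ _ CD0)[fh gh] ht]|].
  by split; exists h.
move=> t [[h fh ht] [h' gh' h't]].
exists h => //; apply/ja_sub_union => //; split=> //.
by rewrite (am_out_inj ht h't).
Qed.

Lemma am_independentE :
  am_independent M <->
  forall s C D, C :&: D = finset.set0 ->
  forall Y1 Y2, AE M C s Y1 -> AE M D s Y2 -> Y1 `&` Y2 !=set0.
Proof.
split=> H s C D CD0.
  move=> _ _ [f fP <-] [g gP <-]; rewrite -outC_union //; exact: H.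
move=> f g fP gP; rewrite /av /= outC_union //.
by apply: (H s C D) => //; [exists f|exists g].
Qed.

Lemma outC_restr C s (f : JA (am_AC M) finset.setT) t : am_out s f t ->
  forall u, outC s (ja_restr f : JA (am_AC M) C) u <->
    exists2 g, am_out s g u & {in C, act f =1 act g}.
Proof.
move=> ft u; split=> [[g /ja_restr_eq fg gu]|[g gu fg]]; exists g => //.
exact/ja_restr_eq.
Qed.

Lemma AE_partition a s : partition (AE M [set a]%SET s) id (am_suc s).
Proof.
split.
- apply/seteqP; split=> [t [_ [f _ <-]]|t [f ft]]; first exact: outC_suc.
  pose k : JA (am_AC M) [set a]%SET := ja_restr f.
  have kt : outC s k t by exists f.
  by exists (outC s k) => //; exists k => //; exists t.
- move=> _ _ [f _ <-] [g _ <-] [t [[h fh ht] [h' gh' h't]]].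
  move: fh gh'; rewrite (am_out_inj ht h't) /= /ja_sub => -> ->.
  by [].
- by move=> _ [f fP <-].
Qed.

Lemma AE_joint_block C s :
  AE M C s =
  [set joint_block (am_suc s) (fun a => AE M [set a]%SET s) [set a | a \in C] t
    | t in am_suc s].
Proof.
(* Sharing a block of agent [a] means that the unique profiles leading to the two successors agree
   at [a]. *)
have same a (f g : JA (am_AC M) finset.setT) t u : am_out s f t -> am_out s g u ->
    (exists2 Z, AE M [set a]%SET s Z & Z u /\ Z t) <-> act f a = act g a.
  move=> ft gu; split.
    move=> [_ [h _ <-] [[g' hg' g'u] [f' hf' f't]]].
    rewrite (am_out_inj ft f't) (am_out_inj gu g'u).
    have : ja_restr f' = ja_restr g' :> JA (am_AC M) [set a]%SET by rewrite -hf'.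
    by move=> /ja_restr_eq; apply; rewrite finset.inE.
  move=> e; pose k : JA (am_AC M) [set a]%SET := ja_restr f.
  have kt : outC s k t by exists f.
  exists (outC s k); first by exists k => //; exists t.
  split=> //; exists g => //; apply/ja_restr_eq => b.
  by rewrite finset.inE => /eqP ->.
(* Hence the joint block of [t] consists of the successors whose profile agrees on [C] with the
   profile [f] of [t]. *)
have key (f : JA (am_AC M) finset.setT) t : am_out s f t ->
    outC s (ja_restr f : JA (am_AC M) C) =
    joint_block (am_suc s) (fun a => AE M [set a]%SET s) [set a | a \in C] t.
  move=> ft; apply/seteqP; split=> u.
    move=> /(outC_restr _ ft)[g gu fg]; split; first by exists g.
    by move=> a Ca; apply/(same a f g) => //; exact: fg.
  move=> [[g gu] H]; apply/(outC_restr _ ft); exists g => // a Ca.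
  by apply/(same a f g t u) => //; exact: H.
apply/seteqP; split.
  move=> _ [f [t [g fg gt]] <-]; exists t; first by exists g.
  by rewrite -(key g t gt) fg.
move=> _ [t [f ft] <-]; rewrite -(key f t ft).
by exists (ja_restr f) => //; exists t, f.
Qed.

End ClearActionModels.

(** * Translations between clear models *)

Section Representability.
Variables (AG : finType) (AP : countType) (ST : Type).

Lemma clear_z_representable (M : action_model AG AP ST)
    (N : nbhd_model AG AP ST) :
  am_clear M -> nm_clear N -> am_L M = nm_L N ->
  (forall s, am_suc M s = nm_suc N s) ->
  (forall a s, AE M [set a]%SET s = nm_nei N a s) ->
  z_representable M N.
Proof.
move=> cM cN eL eS eN; split=> // C; apply/funext => s.
rewrite AE_joint_block // neiC_joint_block // eS.
by under [X in joint_block _ X]funext do rewrite eN.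
Qed.

(** Each optional property of [M] has been restated through the sets [AE M C], which are the sets
    [neiC N C]. As an equivalence, this serves both halves of the theorem. *)
Lemma z_representable_X_model (X : ES) (M : action_model AG AP ST)
    (N : nbhd_model AG AP ST) :
  am_clear M -> z_representable M N ->
  action_X_model X M <-> nbhd_X_model X N.
Proof.
move=> cM [_ eAE].
have eS : am_serial M <-> nm_serial N.
  by rewrite am_serialE /nm_serial; split=> H C s; have := H C s; rewrite eAE.
have eI : am_independent M <-> nm_independent N.
  rewrite am_independentE //; split=> H s C D CD0 Y1 Y2.
    by rewrite -!eAE; exact: H.
  by rewrite !eAE; exact: H.
have eD : am_deterministic M <-> nm_deterministic N.
  rewrite am_deterministicE; split=> H s Y.
    by rewrite -eAE; exact: H.
  by rewrite eAE; exact: H.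
by split=> -[HS HI HD]; split=> h; [exact/eS/HS|exact/eI/HI|exact/eD/HD
  |exact/eS/HS|exact/eI/HI|exact/eD/HD].
Qed.

Section NbhdOfAction.
Variable M : action_model AG AP ST.
Hypothesis cM : am_clear M.

Lemma nbhd_of_action_cover a s : cover (AE M [set a]%SET s) id = am_suc M s.
Proof. by have [] := AE_partition cM a s. Qed.

Lemma nbhd_of_action_neq0 a s : ~ AE M [set a]%SET s set0.
Proof. by have [_ _ H] := AE_partition cM a s; move=> /H []. Qed.

Definition nbhd_of_action : nbhd_model AG AP ST :=
  NbhdModel (am_L M) (am_ST_inhabited M)
    nbhd_of_action_cover nbhd_of_action_neq0.

End NbhdOfAction.

Section ActionOfNbhd.
Variable N : nbhd_model AG AP ST.

(** Any set of states counts as an action; a profile in which some agent picks a set that is not one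
    of its neighborhoods at [s] has no outcome there. *)
Definition action_of_nbhd : action_model AG AP ST :=
  @ActionModel AG AP ST (set ST)
    (fun s f => [set t | nm_suc N s t /\
       forall a, nm_nei N a s (act f a) /\ act f a t])
    (nm_L N) (nm_ST_inhabited N) (inhabits set0).

Hypothesis cN : nm_clear N.

Lemma action_of_nbhd_clear : am_clear action_of_nbhd.
Proof.
move=> s f g fg; apply/seteqP; split=> // t [[_ ft] [_ gt]]; apply: fg.
apply: act_inj => a; have [_ tN _] := cN a s.
have [? ?] := ft a; have [? ?] := gt a.
by apply: tN => //; exists t.
Qed.

Lemma action_of_nbhd_profile s t : nm_suc N s t ->
  exists f, am_out s (f : JA (am_AC action_of_nbhd) finset.setT) t.
Proof.
(* Every agent picks its block containing [t]. *)
move=> St; have /choice[F FP] a : exists Z, nm_nei N a s Z /\ Z t.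
  by have [Z ? ?] := partition_block (cN a s) St; exists Z.
by exists (fun x => F (sval x)).
Qed.

Lemma action_of_nbhd_suc s : am_suc action_of_nbhd s = nm_suc N s.
Proof.
apply/seteqP; split=> [t [f []]|t] //; exact: action_of_nbhd_profile.
Qed.

Lemma action_of_nbhd_AE a s :
  AE action_of_nbhd [set a]%SET s = nm_nei N a s.
Proof.
have out1 (f : JA (am_AC action_of_nbhd) finset.setT) t :
    am_out s f t -> outC s (ja_restr f : JA (am_AC action_of_nbhd) [set a]%SET) = act f a.
  move=> ft; have [_ /(_ a)[fN fat]] := ft.
  apply/seteqP; split=> u.
    move=> /(outC_restr _ ft)[g [_ /(_ a)[_ gu]] /(_ a)].
    by rewrite finset.inE eqxx => /(_ isT) ->.
  (* Let every agent pick its block of [u]: for [a] this is [act f a] again, since two blocks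
     containing [u] coincide. *)
  move=> fu; have [g gu] :=
    action_of_nbhd_profile (partition_subset (cN a s) fN fu).
  apply/(outC_restr _ ft); exists g => // b; rewrite finset.inE => /eqP ->.
  have [_ /(_ a)[gN gau]] := gu; have [_ tN _] := cN a s.
  by apply: tN => //; exists u.
apply/seteqP; split.
  move=> _ [_ [t [f -> ft]] <-]; rewrite (out1 f t) //.
  by have [_ /(_ a)[]] := ft.
move=> Z NZ; have [_ tN /(_ Z NZ)[t Zt]] := cN a s.
have [f ft] := action_of_nbhd_profile (partition_subset (cN a s) NZ Zt).
have [_ /(_ a)[fN fat]] := ft.
exists (ja_restr f); first by exists t, f.
by rewrite (out1 f t) //; apply: tN => //; exists t.
Qed.

End ActionOfNbhd.

End Representability.

Theorem theorem5p9 (AG : finType) (hAG : (0 < #|AG|)%N) (AP : countType) (X : ES) :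
  class_z_representable
    (fun (ST : Type) (M : action_model AG AP ST) => am_clear M /\ action_X_model X M)
    (fun (ST : Type) (N : nbhd_model AG AP ST) => nm_clear N /\ nbhd_X_model X N).
Proof.
split=> ST.
  move=> M [cM XM]; pose N := nbhd_of_action cM.
  have cN : nm_clear N by move=> a s; exact: AE_partition.
  have MN : z_representable M N by exact: clear_z_representable.
  by exists N; split=> //; split=> //; exact/(z_representable_X_model X cM MN).
move=> N [cN XN]; pose M := action_of_nbhd N.
have cM : am_clear M by exact: action_of_nbhd_clear.
have MN : z_representable M N.
  apply: clear_z_representable => //.
  - exact: action_of_nbhd_suc.
  - exact: action_of_nbhd_AE.
by exists M; split=> //; split=> //; exact/(z_representable_X_model X cM MN).
Qed.
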